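(* Let $x_1,\dots,x_5\in\mathbb{R}^3$ be pairwise distinct points with $\sum_{i=1}^5x_i=0$, such that the $5\times3$ matrix $X$ whose $i$-th row is $x_i'$ has rank $3$, and let $M=\sum_{i=1}^5t_iB_i$, with $t$ and $B_i$ as in the context. If either $M$ or $-M$ is positive definite, then there is no cylinder circumscribed to the five points $x_1,\dots,x_5$.
   Context: A cylinder in $\mathbb{R}^3$ is the set of points at distance at most $\rho$ from a line called its axis, where $\rho\ge0$ is its radius. It is circumscribed to the five points if all five lie on its boundary, i.e. at distance exactly $\rho$ from the axis. A prime denotes transposition, $I$ is the $3\times 3$ identity matrix and $Tr$ is the trace. Set $V_i=x_ix_i'$, $T=\sum_{i=1}^5 V_i=X'X$, $V=T/5$, and $B_i=I\cdot Tr(V_i-V)-(V_i-V)$ for $i=1,\dots,5$. Let $\mathbf{1}\in\mathbb{R}^5$ be the vector with all components equal to $1$. The columns of $X$ and $\mathbf{1}$ span a $4$-dimensional subspace of $\mathbb{R}^5$; $t=(t_1,\dots,t_5)'$ is a vector orthogonal to this subspace (so $X't=0$, $\mathbf{1}'t=0$), normalized by $t't=5$, with the sign chosen by convention so that a component of largest absolute value is positive (in case of a tie, any such component may be used). *)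

(* Defs.v *)
From mathcomp Require Import all_boot all_order all_algebra.
From mathcomp Require Import classical_sets reals.

Set Implicit Arguments.
Unset Strict Implicit.
Unset Printing Implicit Defensive.
Import Order.TTheory GRing.Theory Num.Theory.
Local Open Scope classical_set_scope.
Local Open Scope ring_scope.

(* MathComp-Analysis norms matrices by the maximum of the entries, so the
   Euclidean norm of a column vector is introduced here. *)
Definition enorm (R : realType) n (v : 'cV[R]_n) : R :=
  Num.sqrt ((v^T *m v) 0 0).

Definition is_line (R : realType) (L : set 'cV[R]_3) : Prop :=
  exists p u : 'cV[R]_3, u != 0 /\ L = [set p + s *: u | s in [set: R]].

Definition dist_to (R : realType) (L : set 'cV[R]_3) (y : 'cV[R]_3) : R :=
  inf [set enorm (y - z) | z in L].

Record cylinder (R : realType) := Cylinder {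
  axis : set 'cV[R]_3;
  radius : R;
  axisP : is_line axis;
  radius_ge0 : 0 <= radius }.

Definition cylinder_set (R : realType) (C : cylinder R) : set 'cV[R]_3 :=
  [set y | dist_to (axis C) y <= radius C].

(* The boundary of [cylinder_set C]; when the radius is 0 it is the axis. *)
Definition cylinder_boundary (R : realType) (C : cylinder R) : set 'cV[R]_3 :=
  [set y | dist_to (axis C) y = radius C].

Definition circumscribed (R : realType) (C : cylinder R)
    (x : 'I_5 -> 'cV[R]_3) : Prop :=
  forall i, cylinder_boundary C (x i).

Definition pointsmx (R : realType) (x : 'I_5 -> 'cV[R]_3) : 'M[R]_(5, 3) :=
  \matrix_(i < 5) (x i)^T.

Definition Vmx (R : realType) (x : 'I_5 -> 'cV[R]_3) (i : 'I_5) : 'M[R]_3 :=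
  x i *m (x i)^T.

Definition Tmx (R : realType) (x : 'I_5 -> 'cV[R]_3) : 'M[R]_3 :=
  \sum_(i < 5) Vmx x i.

Definition Vmean (R : realType) (x : 'I_5 -> 'cV[R]_3) : 'M[R]_3 :=
  5%:R^-1 *: Tmx x.

Definition Bmx (R : realType) (x : 'I_5 -> 'cV[R]_3) (i : 'I_5) : 'M[R]_3 :=
  (\tr (Vmx x i - Vmean x))%:M - (Vmx x i - Vmean x).

Definition Mmx (R : realType) (x : 'I_5 -> 'cV[R]_3) (t : 'cV[R]_5) :
    'M[R]_3 :=
  \sum_(i < 5) t i 0 *: Bmx x i.

(* [t] is orthogonal to the columns of X and to the all-ones vector, has
   squared norm 5, and is positive at some index of largest absolute value;
   when several indices tie, any of them may serve, so both [t] and [- t] can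
   then qualify. *)
Definition tvector (R : realType) (x : 'I_5 -> 'cV[R]_3) (t : 'cV[R]_5) :
    Prop :=
  [/\ (pointsmx x)^T *m t = 0,
      (const_mx 1 : 'cV[R]_5)^T *m t = 0,
      t^T *m t = 5%:R%:M
    & exists2 i, (forall j, `|t j 0| <= `|t i 0|) & 0 < t i 0].

Definition posdefmx (R : realType) n (A : 'M[R]_n) : Prop :=
  A \is symmetricmx /\
  forall v : 'cV[R]_n, v != 0 -> 0 < (v^T *m A *m v) 0 0.

(* Main.v *)
Require Import Defs.
From mathcomp Require Import all_boot all_order all_algebra.
From mathcomp Require Import classical_sets reals.
From mathcomp Require Import ring.
Local Open Scope ring_scope.

(** Write [a . b] for the scalar product of [R^n].  For a direction [u], the
    number [gram u w = (w . w) (u . u) - (w . u)^2] is [u . u] times the squared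
    distance from [w] to the line spanned by [u].  As a function of [u] it is
    the quadratic form of [Tr(w w') I - w w'], which is where the matrices [B_i]
    come from: since the [t_i] add up to zero, the mean [V] drops out of
    [M = sum_i t_i B_i], and [u' M u = sum_i t_i gram u x_i] ([quad_Mmx]).

    As a function of [w], [gram u] is quadratic, so [gram u (w - p)] differs from
    [gram u w] by an affine function of [w] ([gramB]).  Both the weights and the
    weighted points add up to zero, so the affine part is invisible to the
    weights and [sum_i t_i gram u (x_i - p) = sum_i t_i gram u x_i]
    ([sum_gramB]).

    If the five points lie on the boundary of a cylinder of radius [rho] with
    axis [p + R u], then every [gram u (x_i - p)] equals [rho^2 (u . u)]
    ([sqr_dist_to_line]), so the weighted sum is [rho^2 (u . u) sum_i t_i = 0].
    Hence [u' M u = 0] for the nonzero vector [u], and neither [M] nor [- M] can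
    be positive definite. *)

Import Order.TTheory GRing.Theory Num.Theory.
Local Open Scope classical_set_scope.

Set Implicit Arguments.
Unset Strict Implicit.

Definition dotp (R : realType) n (a b : 'cV[R]_n) : R := (a^T *m b) 0 0.

(** The Gram determinant of [u] and [w]; being free of division, it is
    polynomial in both arguments. *)
Definition gram (R : realType) n (u w : 'cV[R]_n) : R :=
  dotp w w * dotp u u - dotp w u ^+ 2.

Section ScalarProduct.
Variables (R : realType) (n : nat).
Implicit Types a b c u w p : 'cV[R]_n.

Lemma dotpE a b : dotp a b = \sum_j a j 0 * b j 0.
Proof. by rewrite /dotp mxE; apply: eq_bigr => j _; rewrite mxE. Qed.

Lemma dotpC a b : dotp a b = dotp b a.
Proof. by rewrite !dotpE; apply: eq_bigr => j _; rewrite mulrC. Qed.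

Lemma dotpDl a b c : dotp (a + b) c = dotp a c + dotp b c.
Proof. by rewrite /dotp linearD mulmxDl mxE. Qed.

Lemma dotpZl k a b : dotp (k *: a) b = k * dotp a b.
Proof. by rewrite /dotp linearZ -scalemxAl mxE. Qed.

Lemma dotpBl a b c : dotp (a - b) c = dotp a c - dotp b c.
Proof. by rewrite -scaleN1r dotpDl dotpZl mulN1r. Qed.

Lemma dotpBr a b c : dotp a (b - c) = dotp a b - dotp a c.
Proof. by rewrite !(dotpC a) dotpBl. Qed.

Lemma dotpZr k a b : dotp a (k *: b) = k * dotp a b.
Proof. by rewrite !(dotpC a) dotpZl. Qed.

Lemma dotp0l b : dotp 0 b = 0.
Proof. by rewrite /dotp linear0 mul0mx mxE. Qed.

Lemma dotp_suml (I : finType) (F : I -> 'cV[R]_n) b :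
  dotp (\sum_i F i) b = \sum_i dotp (F i) b.
Proof. by rewrite /dotp linear_sum mulmx_suml summxE. Qed.

Lemma dotp_ge0 a : 0 <= dotp a a.
Proof. by rewrite dotpE sumr_ge0 // => j _; rewrite -expr2 sqr_ge0. Qed.

Lemma dotp_gt0 a : a != 0 -> 0 < dotp a a.
Proof.
move=> a0; rewrite lt0r dotp_ge0 andbT; apply: contraNN a0.
rewrite dotpE psumr_eq0 => [/allP a0|j _]; last by rewrite -expr2 sqr_ge0.
apply/eqP/matrixP => j k; rewrite ord1 mxE.
by have := a0 j (mem_index_enum _); rewrite /= -expr2 sqrf_eq0 => /eqP.
Qed.

Lemma gramB u w p :
  gram u (w - p) =
    gram u w + gram u p - 2 * dotp w (dotp u u *: p - dotp p u *: u).
Proof.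
rewrite /gram !(dotpBl, dotpBr, dotpZr) (dotpC p w).
by ring.
Qed.

(** The quadratic part of [gram u] is translation invariant under weights that
    annihilate affine functions. *)
Lemma sum_gramB (I : finType) (t : I -> R) (x : I -> 'cV[R]_n) u p :
    \sum_i t i = 0 -> \sum_i t i *: x i = 0 ->
  \sum_i t i * gram u (x i - p) = \sum_i t i * gram u (x i).
Proof.
move=> t0 tx0; set c := dotp u u *: p - dotp p u *: u.
have -> : \sum_i t i * gram u (x i - p) =
    \sum_i t i * gram u (x i) + (\sum_i t i) * gram u p
    - 2 * dotp (\sum_i t i *: x i) c.
  rewrite dotp_suml mulr_suml mulr_sumr -big_split -sumrB /=.
  by apply: eq_bigr => i _; rewrite gramB dotpZl -/c; ring.
by rewrite t0 tx0 dotp0l mul0r mulr0 subr0 addr0.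
Qed.

(** Completing the square in [s]: the last term vanishes exactly at the foot of
    the perpendicular. *)
Lemma dotp_line_point u w s :
  dotp u u * dotp (w - s *: u) (w - s *: u) =
    gram u w + (s * dotp u u - dotp w u) ^+ 2.
Proof.
by rewrite /gram !(dotpBl, dotpBr, dotpZl, dotpZr) (dotpC u w); ring.
Qed.

End ScalarProduct.

Lemma inf_min (R : realType) (A : set R) m : A m -> lbound A m -> inf A = m.
Proof.
move=> Am lbm; apply/eqP; rewrite eq_le; apply/andP; split.
  by apply: ge_inf => //; exists m.
by apply: lb_le_inf => //; exists m.
Qed.

(** The infimum defining the distance is a minimum, attained at the foot
    [p + (w . u / u . u) u] of the perpendicular, where [w = y - p]. *)
Lemma sqr_dist_to_line (R : realType) (p u y : 'cV[R]_3) : u != 0 ->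
  dist_to [set p + s *: u | s in [set: R]] y ^+ 2 * dotp u u = gram u (y - p).
Proof.
move=> u0; have uu := dotp_gt0 u0.
pose s0 := dotp (y - p) u / dotp u u.
have s0E : s0 * dotp u u - dotp (y - p) u = 0.
  by rewrite divfK ?subrr // gt_eqF.
have foot : dotp u u * dotp (y - (p + s0 *: u)) (y - (p + s0 *: u)) =
    gram u (y - p).
  by rewrite opprD addrA dotp_line_point s0E expr0n addr0.
have -> : dist_to [set p + s *: u | s in [set: R]] y =
    enorm (y - (p + s0 *: u)).
  apply: inf_min.
    by exists (p + s0 *: u) => //; exists s0.
  move=> _ [_ [s _ <-] <-]; apply: ler_wsqrtr.
  rewrite -!/(dotp _ _) -(ler_pM2l uu) foot opprD addrA dotp_line_point.
  by rewrite lerDl sqr_ge0.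
by rewrite sqr_sqrtr ?dotp_ge0 // -/(dotp _ _) mulrC.
Qed.

Lemma mxtrace_outer (R : realType) n (a : 'cV[R]_n) : \tr (a *m a^T) = dotp a a.
Proof. by rewrite mxtrace_mulC /mxtrace big_ord1. Qed.

Lemma quad_tr_sub_outer (R : realType) n (a u : 'cV[R]_n) :
  (u^T *m ((\tr (a *m a^T))%:M - a *m a^T) *m u) 0 0 = gram u a.
Proof.
rewrite mxtrace_outer mulmxBr mulmxBl mul_mx_scalar -scalemxAl.
rewrite (mulmxA u^T a) -(mulmxA (u^T *m a)).
rewrite [LHS]mxE [X in X + _]mxE [X in _ + X]mxE [X in _ - X]mxE big_ord1.
by rewrite -!/(dotp _ _) (dotpC u a) -expr2.
Qed.

Lemma quad_Mmx (R : realType) (x : 'I_5 -> 'cV[R]_3) (t : 'cV[R]_5) u :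
    \sum_i t i 0 = 0 ->
  (u^T *m Mmx x t *m u) 0 0 = \sum_i t i 0 * gram u (x i).
Proof.
move=> t0.
have -> : Mmx x t = \sum_i t i 0 *: ((\tr (Vmx x i))%:M - Vmx x i)
    - (\sum_i t i 0) *: ((\tr (Vmean x))%:M - Vmean x).
  rewrite scaler_suml -sumrB; apply: eq_bigr => i _.
  rewrite -scalerBr /Bmx (raddfB mxtrace) (raddfB scalar_mx) /=.
  by rewrite opprD addrACA -opprD.
rewrite t0 scale0r subr0 mulmx_sumr mulmx_suml summxE; apply: eq_bigr => i _.
by rewrite -scalemxAr -scalemxAl mxE quad_tr_sub_outer.
Qed.

Unset Implicit Arguments.

Theorem lemma2 (R : realType) (x : 'I_5 -> 'cV[R]_3) (t : 'cV[R]_5)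
    (x_inj : injective x)
    (x_centered : \sum_(i < 5) x i = 0)
    (rankX : \rank (pointsmx x) = 3%N)
    (ht : tvector x t)
    (hM : posdefmx (Mmx x t) \/ posdefmx (- Mmx x t)) :
  ~ exists C : cylinder R, circumscribed C x.
Proof.
case: ht => tX t1 _ _ [[L rho [p [u [u0 LE]]] rho0] Cx].
have t0 : \sum_i t i 0 = 0.
  move/matrixP/(_ 0 0): t1; rewrite !mxE; apply: etrans.
  by apply: eq_bigr => i _; rewrite !mxE mul1r.
have tx0 : \sum_i t i 0 *: x i = 0.
  rewrite -[RHS]tX; apply/matrixP => j k; rewrite ord1 summxE mxE.
  by apply: eq_bigr => i _; rewrite !mxE mulrC.
have uMu : (u^T *m Mmx x t *m u) 0 0 = 0.
  rewrite quad_Mmx // -(sum_gramB u p t0 tx0).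
  under eq_bigr => i _ do
    rewrite -sqr_dist_to_line // -LE [dist_to _ _](Cx i) /=.
  by rewrite -mulr_suml t0 mul0r.
case: hM => -[_ /(_ u u0)]; last rewrite mulmxN mulNmx mxE oppr_gt0.
all: by rewrite uMu ltxx.
Qed.
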